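(* (Generalized law of reflection.) Let $s_1,s_2>0$ be real, let $\mu\in\mathbb{C}$ with $\mathrm{Re}\,\mu\ge0$, $\mathrm{Im}\,\mu\le 0$ and $\mathrm{Im}\,\mu\neq0$, and let $S(z)=-s_1$ for $\mathrm{Im}\,z<0$ and $S(z)=s_2$ for $\mathrm{Im}\,z\ge0$. Consider a pair of poles $z,z'$ with strengths $-\mu S(z)$ and $+\mu S(z')$, arriving from the lower half-plane: before time $0$ both poles lie in the lower half-plane $\mathrm{Im}<0$; at time $0$ the pole $z'$ crosses the real axis into the upper half-plane, so $\mathrm{Im}\,z'(0)=0$, while $\mathrm{Im}\,z(0)<0$; and $t>0$ is the next time at which $z'$ again crosses the real axis, so that $\mathrm{Im}\,z'>0$ strictly between the times $0$ and $t$, and $\mathrm{Im}\,z'(t)=0$. Then $z$ does not cross the real axis up to time $t$, and the angles of incidence $\theta_1,\theta_2$ pre- and post-reflection satisfy $$\sin\theta_1\,\exp\Bigl(-\frac{\mathrm{Re}\,\mu}{\mathrm{Im}\,\mu}\,\theta_1\Bigr)=\sin\theta_2\,\exp\Bigl(-\frac{\mathrm{Re}\,\mu}{\mathrm{Im}\,\mu}\,\theta_2\Bigr).$$ If moreover $\mathrm{Re}\,\mu=0$, then $$\theta_1=\pi-\theta_2.$$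
   Context: The bar denotes complex conjugation. The pair moves according to $$\frac{d}{dt}z=\frac{\overline{\mu}\,S(z')}{\overline{z}-\overline{z'}},\qquad \frac{d}{dt}z'=\frac{-\overline{\mu}\,S(z)}{\overline{z'}-\overline{z}},$$ where the trajectories are continuous in time and satisfy the equations on each time interval during which neither pole crosses the discontinuity line $\mathrm{Im}\,z=0$ of $S$. While both poles are in the lower half-plane they move along parallel straight lines with $z'-z$ constant. The angles of incidence are $\theta_1=\arg(z'-z)$ before time $0$ (equivalently $\theta_1=\arg(z'(0)-z(0))$) and $\theta_2=\arg(z'-z)$ after time $t$, when the pair resumes parallel motion in the lower half-plane (equivalently $\theta_2=\arg(z'(t)-z(t))$), the argument being measured from the positive real axis and continuously along the motion, with values in $(0,\pi)$. *)

(* Defs.v *)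
From Stdlib Require Import Reals.
From Coquelicot Require Import Coquelicot.
Open Scope R_scope.

(* The coefficient S(z) of the pole strengths; the value s2 on the line itself matters
   for [pole_motion]. *)
Definition S_jump (s1 s2 : R) (z : C) : R :=
  if Rlt_dec (Im z) 0 then - s1 else s2.

(* The two sides are exactly the sets on which [S_jump] is constant, so the real
   axis is grouped with the upper half-plane. *)
Definition stays_on_one_side (u : R -> C) (c d : R) : Prop :=
  (forall tau, c < tau < d -> Im (u tau) < 0) \/
  (forall tau, c < tau < d -> 0 <= Im (u tau)).

(* The equations of motion at time tau. Division by 0 is total in [C], hence
   the explicit requirement that the poles be distinct. *)
Definition pole_equations (mu : C) (s1 s2 : R) (z z' : R -> C) (tau : R) : Prop :=
  z tau <> z' tau /\
  @is_derive R_AbsRing C_R_NormedModule z tau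
    (Cconj mu * RtoC (S_jump s1 s2 (z' tau)) / (Cconj (z tau) - Cconj (z' tau)))%C /\
  @is_derive R_AbsRing C_R_NormedModule z' tau
    (- Cconj mu * RtoC (S_jump s1 s2 (z tau)) / (Cconj (z' tau) - Cconj (z tau)))%C.

(* [z], [z'] are trajectories of the pair on the open time interval (a, b). *)
Definition pole_motion (mu : C) (s1 s2 a b : R) (z z' : R -> C) : Prop :=
  (forall tau, a < tau < b ->
     @continuous R_UniformSpace C_UniformSpace z tau /\
     @continuous R_UniformSpace C_UniformSpace z' tau) /\
  (forall c d, a <= c -> c < d -> d <= b ->
     stays_on_one_side z c d -> stays_on_one_side z' c d ->
     forall tau, c < tau < d -> pole_equations mu s1 s2 z z' tau).

Definition is_arg (w : C) (theta : R) : Prop :=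
  w <> RtoC 0 /\ w = (Cmod w * cos theta, Cmod w * sin theta).

(* [theta] is arg (z' - z) along the motion; the range (0, PI) makes it
   unique on (a, b). *)
Definition angle_along (a b : R) (z z' : R -> C) (theta : R -> R) : Prop :=
  forall tau, a < tau < b ->
    @continuous R_UniformSpace R_UniformSpace theta tau /\
    0 < theta tau < PI /\
    is_arg (z' tau - z tau)%C (theta tau).

(* Main.v *)
Require Import Defs.
From Stdlib Require Import Reals Lra.
From Coquelicot Require Import Coquelicot.
Open Scope R_scope.

(** Write w = z' - z = x + i y and M for the conjugate of mu. As long as z is in
    the lower half-plane and S(z') has a constant value sigma, the equations read
      z_t = - sigma * M / conj w,    z'_t = s1 * M / conj w,
    so that w_t = (s1 + sigma) * M * w / |w|^2 while s1 * z + sigma * z' stays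
    constant.

    When both poles are below the axis, sigma = - s1 and w is constant. When z'
    is above it, sigma = s2 > 0: the constancy of s1 * Im z + s2 * Im z' keeps z
    below its initial height ([trailing_pole_stays_below]), and it shows that
    y takes the same value at both crossings of z', where Im z' = 0. Moreover w
    runs along a logarithmic spiral: with k = - Re mu / Im mu, the argument
    theta of w increases and ln |w| - k * theta is constant
    ([upper_phase_spiral]). Since y = |w| sin theta, the quantity
    sin theta * exp (k * theta) is proportional to y along the spiral, so it is
    the same at both crossings; for k = 0 this says that the two angles have the
    same sine, and they are distinct because theta increases.

    The angle after time t is constant because the pair really leaves the axis
    ([re_entry]): on the spiral the direction Im (M w) of vertical motion can
    only change from positive to negative, and y has returned to its initial
    value, so Im (M w) < 0 at time t ([upper_phase_exit_slope]). The vertical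
    velocity of z' is then negative whichever side of the axis z' is on, which
    excludes any sliding along the axis or oscillation across it. *)

(** * Calculus on intervals *)

Lemma is_derive_Re_comp (u : R -> C) (x : R) (l : C) :
  @is_derive R_AbsRing C_R_NormedModule u x l ->
  is_derive (fun tau => Re (u tau)) x (Re l).
Proof.
  intros Hu.
  apply (filterdiff_comp u (@fst R R) _ (@fst R R) Hu).
  apply filterdiff_linear, (@is_linear_fst R_AbsRing R_NormedModule R_NormedModule).
Qed.

Lemma is_derive_Im_comp (u : R -> C) (x : R) (l : C) :
  @is_derive R_AbsRing C_R_NormedModule u x l ->
  is_derive (fun tau => Im (u tau)) x (Im l).
Proof.
  intros Hu.
  apply (filterdiff_comp u (@snd R R) _ (@snd R R) Hu).
  apply filterdiff_linear, (@is_linear_snd R_AbsRing R_NormedModule R_NormedModule).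
Qed.

Lemma continuity_pt_Re_comp (u : R -> C) (x : R) :
  @continuous R_UniformSpace C_UniformSpace u x ->
  continuity_pt (fun tau => Re (u tau)) x.
Proof.
  intros Hu. apply continuity_pt_filterlim.
  apply (continuous_comp u (@fst R R) x Hu).
  destruct (u x). apply (@continuous_fst R_UniformSpace R_UniformSpace).
Qed.

Lemma continuity_pt_Im_comp (u : R -> C) (x : R) :
  @continuous R_UniformSpace C_UniformSpace u x ->
  continuity_pt (fun tau => Im (u tau)) x.
Proof.
  intros Hu. apply continuity_pt_filterlim.
  apply (continuous_comp u (@snd R R) x Hu).
  destruct (u x). apply (@continuous_snd R_UniformSpace R_UniformSpace).
Qed.

Lemma mean_value_open (f df : R -> R) (c d : R) :
  c < d ->
  (forall x, c <= x <= d -> continuity_pt f x) ->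
  (forall x, c < x < d -> is_derive f x (df x)) ->
  exists x, c < x < d /\ f d - f c = df x * (d - c).
Proof.
  intros Hcd Hf Hdf.
  assert (pr : forall x, c < x < d -> derivable_pt f x).
  { intros x Hx. exists (df x). apply is_derive_Reals, Hdf, Hx. }
  destruct (MVT f id c d pr (fun x _ => derivable_pt_id x) Hcd Hf) as (x & Hx & Heq).
  { intros x _. apply derivable_continuous_pt, derivable_pt_id. }
  exists x. split; [exact Hx|].
  rewrite derive_pt_id, Derive_Reals, (is_derive_unique _ _ _ (Hdf x Hx)) in Heq.
  unfold id in Heq. lra.
Qed.

Lemma decreasing_on (f df : R -> R) (c d : R) :
  c < d ->
  (forall x, c <= x <= d -> continuity_pt f x) ->
  (forall x, c < x < d -> is_derive f x (df x)) ->
  (forall x, c < x < d -> df x < 0) ->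
  f d < f c.
Proof.
  intros Hcd Hf Hdf Hneg.
  destruct (mean_value_open f df c d Hcd Hf Hdf) as (x & Hx & Heq).
  specialize (Hneg x Hx). nra.
Qed.

Lemma constant_on (f : R -> R) (c d : R) :
  c < d ->
  (forall x, c <= x <= d -> continuity_pt f x) ->
  (forall x, c < x < d -> is_derive f x 0) ->
  f d = f c.
Proof.
  intros Hcd Hf Hdf.
  destruct (mean_value_open f (fun _ => 0) c d Hcd Hf Hdf) as (x & Hx & Heq). lra.
Qed.

Lemma locally_negative (f : R -> R) (x : R) :
  continuity_pt f x -> f x < 0 -> locally x (fun y => f y < 0).
Proof.
  intros Hf Hx. apply continuity_pt_filterlim in Hf.
  apply (Hf (fun y => y < 0)), open_lt, Hx.
Qed.

(** The exit time is the supremum of the times up to which [P] has held;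
    openness of [P] is what makes [P] fail at that time itself. *)
Lemma first_exit (P : R -> Prop) (c d : R) :
  c < d ->
  (forall x, c <= x <= d -> P x -> locally x P) ->
  P c -> ~ P d ->
  exists e, c < e <= d /\ ~ P e /\ forall x, c <= x < e -> P x.
Proof.
  intros Hcd Hopen Hc Hd.
  set (E := fun e => c <= e <= d /\ forall x, c <= x < e -> P x).
  destruct (completeness E) as (e & Hub & Hlub).
  { exists d. intros x [Hx _]. lra. }
  { exists c. split; [lra|]. intros x Hx; lra. }
  assert (He : forall x, c <= x < e -> P x).
  { intros x Hx. apply Classical_Prop.NNPP. intros Hn.
    apply (Rlt_not_le e x); [lra|]. apply Hlub. intros y [Hy HyP].
    destruct (Rle_lt_dec y x); [assumption|].
    elim Hn. apply HyP. lra. }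
  assert (Hce : c <= e). { apply Hub. split; [lra|]. intros x Hx; lra. }
  assert (Hed : e <= d). { apply Hlub. intros y [Hy _]. lra. }
  assert (Hne : ~ P e).
  { intros HPe. destruct (Hopen e (conj Hce Hed) HPe) as [eps Heps].
    assert (Hlt : e < d).
    { destruct Hed as [?|Heq]; [assumption|]. elim Hd. rewrite <- Heq. exact HPe. }
    assert (Hp := cond_pos eps).
    set (e' := Rmin d (e + eps / 2)).
    assert (He' : e < e' <= d /\ e' <= e + eps / 2).
    { unfold e', Rmin. destruct (Rle_dec d (e + eps / 2)); lra. }
    apply (Rlt_not_le e' e); [lra|]. apply Hub. split; [lra|].
    intros x Hx. destruct (Rlt_le_dec x e); [apply He; lra|].
    apply Heps. unfold ball; simpl. unfold AbsRing_ball, abs, minus, plus, opp; simpl.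
    apply Rabs_def1; lra. }
  exists e. split; [|split; assumption].
  destruct Hce as [?|Heq]; [lra|]. elim Hne. rewrite <- Heq. exact Hc.
Qed.

(** * The argument in the upper half-plane *)

(** The argument of x + i y for y > 0, written with the arc cotangent so that
    it decreases strictly with x / y and depends smoothly on x and y. *)
Definition angle_of (x y : R) : R := PI / 2 - atan (x / y).

Lemma angle_of_bounds (x y : R) : 0 < angle_of x y < PI.
Proof. unfold angle_of. assert (H := atan_bound (x / y)). lra. Qed.

Lemma norm_factor (x y : R) :
  0 < y -> sqrt (x ^ 2 + y ^ 2) = y * sqrt (1 + (x / y)²).
Proof.
  intros Hy.
  replace (x ^ 2 + y ^ 2) with (y ^ 2 * (1 + (x / y)²)) by (unfold Rsqr; field; lra).
  rewrite sqrt_mult_alt by nra. rewrite sqrt_pow2; lra.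
Qed.

Lemma angle_of_polar (x y : R) :
  0 < y ->
  x = sqrt (x ^ 2 + y ^ 2) * cos (angle_of x y) /\
  y = sqrt (x ^ 2 + y ^ 2) * sin (angle_of x y).
Proof.
  intros Hy. unfold angle_of.
  rewrite sin_shift, cos_shift, sin_atan, cos_atan, norm_factor by exact Hy.
  assert (0 < sqrt (1 + (x / y)²)).
  { apply sqrt_lt_R0. assert (H := Rle_0_sqr (x / y)). lra. }
  split; field; lra.
Qed.

Lemma is_arg_angle_of (x y : R) : 0 < y -> is_arg (x, y) (angle_of x y).
Proof.
  intros Hy. split.
  - intros H. injection H. lra.
  - unfold Cmod; simpl fst; simpl snd.
    destruct (angle_of_polar x y Hy) as [Hx' Hy']. f_equal; assumption.
Qed.

Lemma angle_of_unique (x y theta : R) :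
  0 < y -> 0 < theta < PI -> is_arg (x, y) theta -> theta = angle_of x y.
Proof.
  intros Hy Ht [Hne Heq]. injection Heq. intros Ey Ex.
  assert (Hs : 0 < sin theta) by (apply sin_gt_0; lra).
  assert (Hr : Cmod (x, y) <> 0) by (apply Rgt_not_eq, Cmod_gt_0, Hne).
  set (r := Cmod (x, y)) in *. clearbody r. unfold angle_of.
  replace (x / y) with (tan (PI / 2 - theta)).
  - rewrite atan_tan; lra.
  - unfold tan. rewrite sin_shift, cos_shift, Ex, Ey. field. split; lra.
Qed.

(** Both sides are y * exp (k * theta) / r in polar coordinates. The form on the
    right isolates the height y from ln r - k * theta, which is constant along
    a logarithmic spiral. *)
Lemma reflection_invariant (k x y : R) :
  0 < y ->
  sin (angle_of x y) * exp (k * angle_of x y)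
    = y * exp (- ((ln (x ^ 2 + y ^ 2) - 2 * k * angle_of x y) / 2)).
Proof.
  intros Hy. destruct (angle_of_polar x y Hy) as [_ Hs].
  assert (HD : 0 < x ^ 2 + y ^ 2) by nra.
  assert (Hr := sqrt_lt_R0 _ HD).
  assert (Hln : ln (x ^ 2 + y ^ 2) = 2 * ln (sqrt (x ^ 2 + y ^ 2))).
  { rewrite <- (sqrt_sqrt (x ^ 2 + y ^ 2)) at 1 by lra. rewrite ln_mult; lra. }
  rewrite Hln.
  set (r := sqrt (x ^ 2 + y ^ 2)) in *. set (theta := angle_of x y) in *.
  replace (- ((2 * ln r - 2 * k * theta) / 2)) with (k * theta + - ln r) by field.
  rewrite exp_plus, exp_Ropp, exp_ln by assumption.
  rewrite Hs. field. lra.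
Qed.

Lemma sin_eq_supplement (u v : R) :
  0 < u < v -> v < PI -> sin u = sin v -> u = PI - v.
Proof.
  intros Hu Hv Heq.
  destruct (Rle_lt_dec v (PI / 2)).
  { assert (u = v) by (apply sin_inj; lra). lra. }
  destruct (Rle_lt_dec u (PI / 2)).
  { apply sin_inj; try lra. rewrite sin_PI_x. exact Heq. }
  assert (PI - u = PI - v) by (apply sin_inj; rewrite ?sin_PI_x; lra). lra.
Qed.

(** * The equations of motion in real coordinates *)

Definition sep_re (z z' : R -> C) (tau : R) : R := Re (z' tau) - Re (z tau).
Definition sep_im (z z' : R -> C) (tau : R) : R := Im (z' tau) - Im (z tau).

(** The real and imaginary parts of conj mu / conj w for w = x + i y, which give
    the common direction in which both poles move. *)
Definition slope_re (mu : C) (x y : R) : R :=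
  (Re mu * x + Im mu * y) / (x ^ 2 + y ^ 2).
Definition slope_im (mu : C) (x y : R) : R :=
  (Re mu * y - Im mu * x) / (x ^ 2 + y ^ 2).

(** Motion on [c, d] with z below the axis, where S(z) = - s1, and with the
    constant value [sigma] of S(z'). The equations hold on the open interval
    only: at its ends a pole may be crossing the axis. *)
Definition phase (mu : C) (s1 sigma c d : R) (z z' : R -> C) : Prop :=
  (forall tau, c <= tau <= d ->
     @continuous R_UniformSpace C_UniformSpace z tau /\
     @continuous R_UniformSpace C_UniformSpace z' tau) /\
  forall tau, c < tau < d ->
    let x := sep_re z z' tau in
    let y := sep_im z z' tau in
    0 < x ^ 2 + y ^ 2 /\
    is_derive (fun t => Re (z t)) tau (- sigma * slope_re mu x y) /\
    is_derive (fun t => Im (z t)) tau (- sigma * slope_im mu x y) /\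
    is_derive (fun t => Re (z' t)) tau (s1 * slope_re mu x y) /\
    is_derive (fun t => Im (z' t)) tau (s1 * slope_im mu x y).

Ltac velocity_component Hl Ex Ey :=
  evar_last; [exact Hl|];
  unfold Cdiv, Cinv, Cminus, Cplus, Copp, Cmult, Cconj, RtoC, Re, Im;
  cbn [fst snd]; rewrite Ex, Ey; field; nra.

Lemma phase_of_motion (mu : C) (s1 s2 a b c d sigma : R) (z z' : R -> C) :
  pole_motion mu s1 s2 a b z z' ->
  a < c -> c < d -> d < b ->
  (forall tau, c < tau < d -> Im (z tau) < 0) ->
  stays_on_one_side z' c d ->
  (forall tau, c < tau < d -> S_jump s1 s2 (z' tau) = sigma) ->
  phase mu s1 sigma c d z z'.
Proof.
  intros [Hcont Heqs] Hac Hcd Hdb Hz Hz' Hsigma. split.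
  { intros tau Htau. apply Hcont. lra. }
  intros tau Htau x y.
  destruct (Heqs c d ltac:(lra) Hcd ltac:(lra) (or_introl Hz) Hz' tau Htau)
    as (Hne & Hd & Hd').
  rewrite (Hsigma tau Htau) in Hd.
  assert (HS : S_jump s1 s2 (z tau) = - s1).
  { unfold S_jump. destruct (Rlt_dec (Im (z tau)) 0) as [_|n]; [reflexivity|].
    elim n. apply Hz, Htau. }
  rewrite HS in Hd'.
  assert (HD : 0 < x ^ 2 + y ^ 2).
  { destruct (Req_dec x 0) as [Hx|Hx]; [|nra].
    destruct (Req_dec y 0) as [Hy|Hy]; [|nra].
    elim Hne. unfold x, y, sep_re, sep_im in Hx, Hy.
    destruct (z tau), (z' tau). simpl in Hx, Hy. f_equal; lra. }
  split; [exact HD|].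
  unfold slope_re, slope_im.
  assert (Ex : fst (z' tau) = fst (z tau) + x) by (unfold x, sep_re, Re; ring).
  assert (Ey : snd (z' tau) = snd (z tau) + y) by (unfold y, sep_im, Im; ring).
  clearbody x y.
  assert (HdRe := is_derive_Re_comp _ _ _ Hd).
  assert (HdIm := is_derive_Im_comp _ _ _ Hd).
  assert (HdRe' := is_derive_Re_comp _ _ _ Hd').
  assert (HdIm' := is_derive_Im_comp _ _ _ Hd').
  split; [|split; [|split]].
  - velocity_component HdRe Ex Ey.
  - velocity_component HdIm Ex Ey.
  - velocity_component HdRe' Ex Ey.
  - velocity_component HdIm' Ex Ey.
Qed.

(** * Conservation laws and monotonicity within a phase *)

Lemma phase_sub (mu : C) (s1 sigma c d c' d' : R) (z z' : R -> C) :
  phase mu s1 sigma c d z z' -> c <= c' -> d' <= d -> phase mu s1 sigma c' d' z z'.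
Proof.
  intros [Hcont Hder] Hc Hd.
  split; intros tau Htau; [apply Hcont | apply Hder]; lra.
Qed.

Lemma sep_continuity (z z' : R -> C) (tau : R) :
  @continuous R_UniformSpace C_UniformSpace z tau ->
  @continuous R_UniformSpace C_UniformSpace z' tau ->
  continuity_pt (sep_re z z') tau /\ continuity_pt (sep_im z z') tau.
Proof.
  intros Hz Hz'. split.
  - apply (continuity_pt_minus (fun t => Re (z' t)) (fun t => Re (z t)));
      apply continuity_pt_Re_comp; assumption.
  - apply (continuity_pt_minus (fun t => Im (z' t)) (fun t => Im (z t)));
      apply continuity_pt_Im_comp; assumption.
Qed.

Lemma phase_sep_continuity (mu : C) (s1 sigma c d : R) (z z' : R -> C) :
  phase mu s1 sigma c d z z' ->
  forall tau, c <= tau <= d ->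
    continuity_pt (sep_re z z') tau /\ continuity_pt (sep_im z z') tau.
Proof.
  intros [Hcont _] tau Htau. apply sep_continuity; apply Hcont, Htau.
Qed.

Lemma phase_sep_derive (mu : C) (s1 sigma c d : R) (z z' : R -> C) :
  phase mu s1 sigma c d z z' ->
  forall tau, c < tau < d ->
    let x := sep_re z z' tau in
    let y := sep_im z z' tau in
    is_derive (sep_re z z') tau ((s1 + sigma) * slope_re mu x y) /\
    is_derive (sep_im z z') tau ((s1 + sigma) * slope_im mu x y).
Proof.
  intros [_ Hder] tau Htau x y.
  destruct (Hder tau Htau) as (_ & Hr & Hi & Hr' & Hi'). fold x y in Hr, Hi, Hr', Hi'.
  split; (evar_last;
    [ unfold sep_re, sep_im; apply @is_derive_minus; eassumption
    | unfold minus, plus, opp; simpl; ring ]).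
Qed.

Lemma lower_phase_sep_constant (mu : C) (s1 c d : R) (z z' : R -> C) :
  phase mu s1 (- s1) c d z z' -> c < d ->
  sep_re z z' d = sep_re z z' c /\ sep_im z z' d = sep_im z z' c.
Proof.
  intros Hph Hcd.
  assert (Hcont := phase_sep_continuity _ _ _ _ _ _ _ Hph).
  assert (Hder := phase_sep_derive _ _ _ _ _ _ _ Hph).
  split; apply constant_on; try assumption.
  - intros tau Htau. apply Hcont, Htau.
  - intros tau Htau. evar_last; [apply Hder, Htau|]. ring.
  - intros tau Htau. apply Hcont, Htau.
  - intros tau Htau. evar_last; [apply Hder, Htau|]. ring.
Qed.

(** The velocities of z and z' are - sigma and s1 times the same vector, so
    s1 * z + sigma * z' is constant; this is its imaginary part. *)
Lemma phase_height_balance (mu : C) (s1 sigma c d : R) (z z' : R -> C) :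
  phase mu s1 sigma c d z z' -> c < d ->
  s1 * Im (z d) + sigma * Im (z' d) = s1 * Im (z c) + sigma * Im (z' c).
Proof.
  intros [Hcont Hder] Hcd.
  apply (constant_on (fun t => s1 * Im (z t) + sigma * Im (z' t))); [exact Hcd| |].
  - intros tau Htau. destruct (Hcont tau Htau) as [Hz Hz'].
    apply continuity_pt_plus.
    + apply (continuity_pt_scal (fun t => Im (z t))), continuity_pt_Im_comp, Hz.
    + apply (continuity_pt_scal (fun t => Im (z' t))), continuity_pt_Im_comp, Hz'.
  - intros tau Htau. destruct (Hder tau Htau) as (_ & _ & Hi & _ & Hi').
    evar_last.
    + apply @is_derive_plus; apply is_derive_scal; eassumption.
    + unfold plus; simpl. ring.
Qed.

(** The hypothesis is Im (conj mu * w) < 0, and the vertical velocity of z' is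
    s1 * Im (conj mu * w) / |w|^2 for every value of [sigma]. *)
Lemma phase_descent (mu : C) (s1 sigma c d : R) (z z' : R -> C) :
  0 < s1 -> phase mu s1 sigma c d z z' -> c < d ->
  (forall tau, c < tau < d -> Re mu * sep_im z z' tau - Im mu * sep_re z z' tau < 0) ->
  Im (z' d) < Im (z' c).
Proof.
  intros Hs1 [Hcont Hder] Hcd Hneg.
  apply (decreasing_on (fun t => Im (z' t))
    (fun t => s1 * slope_im mu (sep_re z z' t) (sep_im z z' t))); [exact Hcd| | |].
  - intros tau Htau. apply continuity_pt_Im_comp, Hcont, Htau.
  - intros tau Htau. apply Hder, Htau.
  - intros tau Htau. destruct (Hder tau Htau) as (HD & _).
    unfold slope_im.
    assert (0 < / (sep_re z z' tau ^ 2 + sep_im z z' tau ^ 2)) by (apply Rinv_0_lt_compat, HD).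
    specialize (Hneg tau Htau). unfold Rdiv.
    assert (0 < s1 * / (sep_re z z' tau ^ 2 + sep_im z z' tau ^ 2))
      by (apply Rmult_lt_0_compat; assumption).
    nra.
Qed.

(** The derivative of x / y = cot theta is (s1 + sigma) * Im mu / y^2: the
    argument of w increases. *)
Lemma upper_phase_ratio_decreases (mu : C) (s1 sigma c d : R) (z z' : R -> C) :
  0 < s1 + sigma -> Im mu < 0 -> phase mu s1 sigma c d z z' -> c < d ->
  (forall tau, c <= tau <= d -> 0 < sep_im z z' tau) ->
  sep_re z z' d / sep_im z z' d < sep_re z z' c / sep_im z z' c.
Proof.
  intros Hs Hmu Hph Hcd Hy.
  assert (Hcont := phase_sep_continuity _ _ _ _ _ _ _ Hph).
  assert (Hder := phase_sep_derive _ _ _ _ _ _ _ Hph).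
  apply (decreasing_on (fun t => sep_re z z' t / sep_im z z' t)
    (fun t => (s1 + sigma) * Im mu / sep_im z z' t ^ 2)); [exact Hcd| | |].
  - intros tau Htau. specialize (Hy tau Htau).
    apply (continuity_pt_div (sep_re z z') (sep_im z z')); try apply Hcont; lra.
  - intros tau Htau. destruct (Hder tau Htau) as [Hx' Hy'].
    specialize (Hy tau ltac:(lra)).
    evar_last.
    + apply is_derive_div; [exact Hx' | exact Hy' | lra].
    + unfold slope_re, slope_im. field. split; nra.
  - intros tau Htau. specialize (Hy tau ltac:(lra)).
    assert (0 < / sep_im z z' tau ^ 2) by (apply Rinv_0_lt_compat, pow_lt, Hy).
    assert (0 < (s1 + sigma) * / sep_im z z' tau ^ 2) by (apply Rmult_lt_0_compat; assumption).
    unfold Rdiv. nra.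
Qed.

(** Im (conj mu * w) = y * (Re mu - Im mu * (x / y)), and its second factor
    decreases with x / y. Were it nonnegative at time d, it would be positive
    throughout [c, d), and y would have grown from c to d. *)
Lemma upper_phase_exit_slope (mu : C) (s1 sigma c d : R) (z z' : R -> C) :
  0 < s1 + sigma -> Im mu < 0 -> phase mu s1 sigma c d z z' -> c < d ->
  (forall tau, c <= tau <= d -> 0 < sep_im z z' tau) ->
  sep_im z z' d = sep_im z z' c ->
  Re mu * sep_im z z' d - Im mu * sep_re z z' d < 0.
Proof.
  intros Hs Hmu Hph Hcd Hy Heq.
  destruct (Rlt_le_dec (Re mu * sep_im z z' d - Im mu * sep_re z z' d) 0) as [H|H];
    [exact H | exfalso].
  assert (Hfac : forall tau, c <= tau <= d ->
    Re mu * sep_im z z' tau - Im mu * sep_re z z' tau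
      = sep_im z z' tau * (Re mu - Im mu * (sep_re z z' tau / sep_im z z' tau))).
  { intros tau Htau. specialize (Hy tau Htau). field. lra. }
  destruct (mean_value_open (sep_im z z')
    (fun t => (s1 + sigma) * slope_im mu (sep_re z z' t) (sep_im z z' t)) c d Hcd)
    as (tau & Htau & Hmv).
  { intros tau Htau. apply (phase_sep_continuity _ _ _ _ _ _ _ Hph), Htau. }
  { intros tau Htau. apply (phase_sep_derive _ _ _ _ _ _ _ Hph), Htau. }
  assert (Hratio : sep_re z z' d / sep_im z z' d < sep_re z z' tau / sep_im z z' tau).
  { apply (upper_phase_ratio_decreases mu s1 sigma); try assumption; try lra.
    - apply (phase_sub _ _ _ c d _ _ _ _ Hph); lra.
    - intros t Ht. apply Hy. lra. }
  rewrite (Hfac d) in H by lra.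
  assert (Hyd := Hy d ltac:(lra)). assert (Hyt := Hy tau ltac:(lra)).
  assert (Hd : 0 <= Re mu - Im mu * (sep_re z z' d / sep_im z z' d)).
  { apply (Rmult_le_reg_l (sep_im z z' d)); lra. }
  assert (Ht : 0 < Re mu - Im mu * (sep_re z z' tau / sep_im z z' tau)) by nra.
  assert (Hpos : 0 < (s1 + sigma) * slope_im mu (sep_re z z' tau) (sep_im z z' tau)).
  { apply Rmult_lt_0_compat; [exact Hs|]. unfold slope_im.
    rewrite (Hfac tau) by lra. apply Rdiv_lt_0_compat; [|nra].
    apply Rmult_lt_0_compat; assumption. }
  nra.
Qed.

Definition sep_angle (z z' : R -> C) (tau : R) : R :=
  angle_of (sep_re z z' tau) (sep_im z z' tau).

Lemma continuity_pt_sep_angle (z z' : R -> C) (tau : R) :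
  continuity_pt (sep_re z z') tau -> continuity_pt (sep_im z z') tau ->
  0 < sep_im z z' tau -> continuity_pt (sep_angle z z') tau.
Proof.
  intros Hx Hy Hpos.
  apply (continuity_pt_minus (fun _ => PI / 2)
           (fun t => atan (sep_re z z' t / sep_im z z' t))).
  - apply continuity_pt_const. intros ? ?. reflexivity.
  - apply (continuity_pt_comp (fun t => sep_re z z' t / sep_im z z' t) atan).
    + apply continuity_pt_div; try assumption. lra.
    + apply derivable_continuous_pt, derivable_pt_atan.
Qed.

(** From w_t / w = (s1 + sigma) * conj mu / |w|^2 one reads off
      (ln |w|)_t = (s1 + sigma) * Re mu / |w|^2   and
      theta_t = - (s1 + sigma) * Im mu / |w|^2,
    whose ratio is the constant - Re mu / Im mu. *)
Lemma upper_phase_spiral (mu : C) (s1 sigma c d : R) (z z' : R -> C) :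
  Im mu < 0 -> phase mu s1 sigma c d z z' -> c < d ->
  (forall tau, c <= tau <= d -> 0 < sep_im z z' tau) ->
  let F tau := ln (sep_re z z' tau ^ 2 + sep_im z z' tau ^ 2)
               - 2 * - (Re mu / Im mu) * sep_angle z z' tau in
  F d = F c.
Proof.
  intros Hmu Hph Hcd Hy F.
  assert (Hcont := phase_sep_continuity _ _ _ _ _ _ _ Hph).
  assert (Hder := phase_sep_derive _ _ _ _ _ _ _ Hph).
  apply (constant_on F); [exact Hcd| |].
  - intros tau Htau. specialize (Hy tau Htau). destruct (Hcont tau Htau) as [Hx Hy'].
    apply continuity_pt_minus.
    + apply (continuity_pt_comp (fun t => sep_re z z' t ^ 2 + sep_im z z' t ^ 2) ln).
      * apply continuity_pt_plus;
          apply (continuity_pt_comp _ (fun u => u ^ 2)); try assumption;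
          apply derivable_continuous_pt, derivable_pt_pow.
      * apply derivable_continuous_pt. eexists. apply derivable_pt_lim_ln. nra.
    + apply (continuity_pt_scal (sep_angle z z')), continuity_pt_sep_angle; assumption.
  - intros tau Htau. destruct (Hder tau Htau) as [Hx' Hy'].
    specialize (Hy tau ltac:(lra)).
    unfold F, sep_angle, angle_of.
    set (X := sep_re z z') in *. set (Y := sep_im z z') in *.
    auto_derive.
    + repeat split; try (eexists; eassumption); nra.
    + change (fun x => X x) with X. change (fun x => Y x) with Y.
      rewrite (is_derive_unique _ _ _ Hx'), (is_derive_unique _ _ _ Hy').
      unfold slope_re, slope_im. field. repeat split; nra.
Qed.

(** * The course of the motion *)

Lemma lower_phase_of_motion (mu : C) (s1 s2 a b c d : R) (z z' : R -> C) :
  pole_motion mu s1 s2 a b z z' -> a < c -> c < d -> d < b ->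
  (forall tau, c < tau < d -> Im (z tau) < 0) ->
  (forall tau, c < tau < d -> Im (z' tau) < 0) ->
  phase mu s1 (- s1) c d z z'.
Proof.
  intros Hmot Hac Hcd Hdb Hz Hz'.
  apply (phase_of_motion _ _ s2 a b); try assumption.
  - left. exact Hz'.
  - intros tau Htau. unfold S_jump.
    destruct (Rlt_dec (Im (z' tau)) 0) as [_|n]; [reflexivity | elim n; auto].
Qed.

Lemma upper_phase_of_motion (mu : C) (s1 s2 a b c d : R) (z z' : R -> C) :
  pole_motion mu s1 s2 a b z z' -> a < c -> c < d -> d < b ->
  (forall tau, c < tau < d -> Im (z tau) < 0) ->
  (forall tau, c < tau < d -> 0 <= Im (z' tau)) ->
  phase mu s1 s2 c d z z'.
Proof.
  intros Hmot Hac Hcd Hdb Hz Hz'.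
  apply (phase_of_motion _ _ s2 a b); try assumption.
  - right. exact Hz'.
  - intros tau Htau. unfold S_jump. specialize (Hz' tau Htau).
    destruct (Rlt_dec (Im (z' tau)) 0); [lra | reflexivity].
Qed.

(** At a first time e when z reaches the axis, the balance
    s1 * Im z + s2 * Im z' of the upper phase would give
    s1 * Im (z e) <= s1 * Im (z c) < 0. *)
Lemma trailing_pole_stays_below (mu : C) (s1 s2 a b c d : R) (z z' : R -> C) :
  0 < s1 -> 0 < s2 -> pole_motion mu s1 s2 a b z z' -> a < c -> d < b ->
  Im (z c) < 0 -> Im (z' c) = 0 ->
  (forall tau, c < tau <= d -> 0 <= Im (z' tau)) ->
  forall tau, c <= tau <= d -> Im (z tau) < 0.
Proof.
  intros Hs1 Hs2 Hmot Hac Hdb Hzc Hz'c Hz' tau Htau.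
  destruct (Rlt_le_dec (Im (z tau)) 0) as [H|H]; [exact H|exfalso].
  assert (Hlt : c < tau).
  { destruct Htau as [[?|<-] _]; [assumption|lra]. }
  destruct (first_exit (fun t => Im (z t) < 0) c tau Hlt) as (e & He & Hne & Hbelow).
  - intros t Ht. apply (locally_negative (fun t => Im (z t))).
    apply continuity_pt_Im_comp, (proj1 Hmot). lra.
  - exact Hzc.
  - lra.
  - assert (Hph : phase mu s1 s2 c e z z').
    { apply (upper_phase_of_motion _ _ _ a b); try assumption; try lra.
      - intros t Ht. apply Hbelow. lra.
      - intros t Ht. apply Hz'. lra. }
    assert (Hbal := phase_height_balance _ _ _ _ _ _ _ Hph ltac:(lra)).
    assert (Hz'e := Hz' e ltac:(lra)). rewrite Hz'c in Hbal. apply Hne. nra.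
Qed.

(** The equations of motion say nothing on an interval in which z' changes
    sides, so oscillation around the axis has to be excluded. Close to t the
    pole z' descends on every interval on which it stays on one side. Suppose
    that it is on or above the axis at time tau. If it was never below between t
    and tau, it has descended from 0 to a nonnegative height; if it was below at
    some time x, it has descended from a negative height until it met the axis.
    Both are absurd. *)
Lemma re_entry_near (mu : C) (s1 s2 a b t : R) (z z' : R -> C) :
  0 < s1 -> pole_motion mu s1 s2 a b z z' -> a < t < b ->
  Im (z t) < 0 -> Im (z' t) = 0 ->
  Re mu * sep_im z z' t - Im mu * sep_re z z' t < 0 ->
  exists t', t < t' < b /\
    forall tau, t < tau <= t' -> Im (z tau) < 0 /\ Im (z' tau) < 0.
Proof.
  intros Hs1 Hmot Ht Hz Hz' Hslope.
  set (N := fun tau => Re mu * sep_im z z' tau - Im mu * sep_re z z' tau) in *.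
  destruct (proj1 Hmot t Ht) as [Hct Hct'].
  destruct (sep_continuity z z' t Hct Hct') as [Hcre Hcim].
  assert (Hnear : locally t (fun tau => Im (z tau) < 0 /\ N tau < 0 /\ tau < b)).
  { apply filter_and; [|apply filter_and].
    - apply (locally_negative (fun tau => Im (z tau))); [|exact Hz].
      apply continuity_pt_Im_comp, Hct.
    - apply (locally_negative N); [|exact Hslope].
      apply (continuity_pt_minus (fun tau => Re mu * sep_im z z' tau)
                                 (fun tau => Im mu * sep_re z z' tau));
        apply continuity_pt_scal; assumption.
    - apply (open_lt b t). lra. }
  destruct Hnear as [eps Heps].
  assert (Hp := cond_pos eps).
  assert (Hin : forall tau, t <= tau <= t + eps / 2 -> Im (z tau) < 0 /\ N tau < 0 /\ tau < b).
  { intros tau Htau. apply Heps. unfold ball; simpl.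
    unfold AbsRing_ball, abs, minus, plus, opp; simpl. apply Rabs_def1; lra. }
  exists (t + eps / 2).
  split. { split; [lra|]. apply (Hin (t + eps / 2)). lra. }
  assert (Hdown : forall sigma c d, t <= c -> c < d -> d <= t + eps / 2 ->
    phase mu s1 sigma c d z z' -> Im (z' d) < Im (z' c)).
  { intros sigma c d Hc Hcd Hd Hph. apply (phase_descent mu s1 sigma c d z z'); try assumption.
    intros tau Htau. apply Hin. lra. }
  intros tau Htau. split; [apply Hin; lra|].
  destruct (Rlt_le_dec (Im (z' tau)) 0) as [H|H]; [exact H|exfalso].
  assert (Htaub : tau < b) by (apply Hin; lra).
  assert (Hall : forall x, t < x < tau -> 0 <= Im (z' x)).
  { intros x Hx. destruct (Rlt_le_dec (Im (z' x)) 0) as [Hneg|]; [exfalso|assumption].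
    destruct (first_exit (fun u => Im (z' u) < 0) x tau) as (e & He & Hne & Hbelow).
    - lra.
    - intros u Hu. apply (locally_negative (fun u => Im (z' u))).
      apply continuity_pt_Im_comp, (proj1 Hmot). lra.
    - exact Hneg.
    - lra.
    - assert (Im (z' e) < Im (z' x)); [|lra].
      apply (Hdown (- s1)); try lra.
      apply (lower_phase_of_motion _ _ s2 a b); try assumption; try lra.
      + intros u Hu. apply Hin. lra.
      + intros u Hu. apply Hbelow. lra. }
  assert (Im (z' tau) < Im (z' t)); [|lra].
  apply (Hdown s2); try lra.
  apply (upper_phase_of_motion _ _ _ a b); try assumption; try lra.
  intros u Hu. apply Hin. lra.
Qed.

(** Once both poles are below the axis, w keeps the value w(t), so both heights
    decrease and neither pole can come back to the axis. *)
Lemma re_entry (mu : C) (s1 s2 a b t : R) (z z' : R -> C) :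
  0 < s1 -> pole_motion mu s1 s2 a b z z' -> a < t < b ->
  Im (z t) < 0 -> Im (z' t) = 0 ->
  Re mu * sep_im z z' t - Im mu * sep_re z z' t < 0 ->
  forall tau, t < tau < b -> Im (z tau) < 0 /\ Im (z' tau) < 0.
Proof.
  intros Hs1 Hmot Ht Hz Hz' Hslope tau Htau.
  destruct (re_entry_near mu s1 s2 a b t z z') as (t' & Ht' & Hnear); try assumption.
  destruct (Rle_lt_dec tau t') as [Hle|Hlt]; [apply Hnear; lra|].
  set (P := fun u => Im (z u) < 0 /\ Im (z' u) < 0).
  apply Classical_Prop.NNPP. intros Hnot.
  destruct (first_exit P t' tau Hlt) as (e & He & Hne & Hbelow).
  - intros u Hu [Hu1 Hu2]. destruct (proj1 Hmot u ltac:(lra)) as [Hc Hc'].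
    apply filter_and.
    + apply (locally_negative (fun u => Im (z u))); [|exact Hu1].
      apply continuity_pt_Im_comp, Hc.
    + apply (locally_negative (fun u => Im (z' u))); [|exact Hu2].
      apply continuity_pt_Im_comp, Hc'.
  - apply Hnear. lra.
  - exact Hnot.
  - assert (HP : forall u, t < u < e -> P u).
    { intros u Hu. destruct (Rle_lt_dec u t'); [apply Hnear | apply Hbelow]; lra. }
    assert (Hph : forall u, t < u <= e -> phase mu s1 (- s1) t u z z').
    { intros u Hu. apply (lower_phase_of_motion _ _ s2 a b); try assumption; try lra;
        intros v Hv; apply HP; lra. }
    assert (Hdown : Im (z' e) < Im (z' t)).
    { apply (phase_descent mu s1 (- s1) t e z z'); try assumption; try lra.
      - apply Hph. lra.
      - intros u Hu.
        destruct (lower_phase_sep_constant mu s1 t u z z') as [-> ->];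
          [apply Hph; lra | lra | exact Hslope]. }
    assert (Hbal := phase_height_balance _ _ _ _ _ _ _ (Hph e ltac:(lra)) ltac:(lra)).
    apply Hne. split; [|lra]. nra.
Qed.

Theorem mainTheorem5 :
  forall (s1 s2 : R) (mu : C) (z z' : R -> C) (a t b : R),
    0 < s1 -> 0 < s2 ->
    0 <= Re mu -> Im mu <= 0 -> Im mu <> 0 ->
    a < 0 -> 0 < t -> t < b ->
    pole_motion mu s1 s2 a b z z' ->
    (forall tau, a < tau < 0 -> Im (z tau) < 0 /\ Im (z' tau) < 0) ->
    Im (z' 0) = 0 -> Im (z 0) < 0 ->
    (forall tau, 0 < tau < t -> 0 < Im (z' tau)) ->
    Im (z' t) = 0 ->
    (forall tau, a < tau <= t -> Im (z tau) < 0) /\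
    (exists theta : R -> R, angle_along a b z z' theta) /\
    (forall theta : R -> R, angle_along a b z z' theta ->
     (* the angles of incidence, read at any time up to 0 and from t on *)
     forall tau1 tau2, a < tau1 <= 0 -> t <= tau2 < b ->
       let theta1 := theta tau1 in
       let theta2 := theta tau2 in
       sin theta1 * exp (- (Re mu / Im mu) * theta1)
         = sin theta2 * exp (- (Re mu / Im mu) * theta2) /\
       (Re mu = 0 -> theta1 = PI - theta2)).
Proof.
  intros s1 s2 mu z z' a t b Hs1 Hs2 _ Hmu_le Hmu_ne Ha Ht Hb Hmot Hbefore
    Hz'0 Hz0 Hup Hz't.
  assert (Hmu : Im mu < 0) by lra.
  assert (Hup' : forall tau, 0 <= tau <= t -> 0 <= Im (z' tau)).
  { intros tau Htau.
    destruct (Req_dec tau 0) as [->|]; [lra|].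
    destruct (Req_dec tau t) as [->|]; [lra|].
    left. apply Hup. lra. }
  assert (Hz : forall tau, 0 <= tau <= t -> Im (z tau) < 0).
  { apply (trailing_pole_stays_below mu s1 s2 a b 0 t z z'); try assumption.
    intros tau Htau. apply Hup'. lra. }
  assert (Hph : phase mu s1 s2 0 t z z').
  { apply (upper_phase_of_motion _ _ _ a b); try assumption.
    - intros tau Htau. apply Hz. lra.
    - intros tau Htau. apply Hup'. lra. }
  assert (Hy : forall tau, 0 <= tau <= t -> 0 < sep_im z z' tau).
  { intros tau Htau. unfold sep_im. specialize (Hz tau Htau). specialize (Hup' tau Htau). lra. }
  assert (Hyeq : sep_im z z' t = sep_im z z' 0).
  { assert (Hbal := phase_height_balance _ _ _ _ _ _ _ Hph Ht).
    unfold sep_im. rewrite Hz'0, Hz't in *.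
    assert (Im (z t) = Im (z 0)) by (apply (Rmult_eq_reg_l s1); lra). lra. }
  assert (Hafter := re_entry mu s1 s2 a b t z z' Hs1 Hmot ltac:(lra)
    (Hz t ltac:(lra)) Hz't
    (upper_phase_exit_slope mu s1 s2 0 t z z' ltac:(lra) Hmu Hph Ht Hy Hyeq)).
  assert (Hsep1 : forall tau, a < tau <= 0 ->
    sep_re z z' tau = sep_re z z' 0 /\ sep_im z z' tau = sep_im z z' 0).
  { intros tau [Htau [H0| ->]]; [|split; reflexivity].
    destruct (lower_phase_sep_constant mu s1 tau 0 z z') as [-> ->]; try lra.
    apply (lower_phase_of_motion _ _ s2 a b); try assumption; try lra;
      intros u Hu; apply Hbefore; lra. }
  assert (Hsep2 : forall tau, t <= tau < b ->
    sep_re z z' tau = sep_re z z' t /\ sep_im z z' tau = sep_im z z' t).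
  { intros tau [[Htau| <-] H0]; [|split; reflexivity].
    apply (lower_phase_sep_constant mu s1 t tau z z'); try lra.
    apply (lower_phase_of_motion _ _ s2 a b); try assumption; try lra;
      intros u Hu; apply Hafter; lra. }
  assert (Hypos : forall tau, a < tau < b -> 0 < sep_im z z' tau).
  { intros tau Htau.
    destruct (Rle_lt_dec tau 0); [rewrite (proj2 (Hsep1 tau ltac:(lra))); apply Hy; lra|].
    destruct (Rle_lt_dec tau t); [apply Hy; lra|].
    rewrite (proj2 (Hsep2 tau ltac:(lra))). apply Hy. lra. }
  assert (Hsplit : forall tau, (z' tau - z tau)%C = (sep_re z z' tau, sep_im z z' tau))
    by reflexivity.
  split; [|split].
  - intros tau Htau. destruct (Rlt_le_dec tau 0); [apply Hbefore | apply Hz]; lra.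
  - exists (sep_angle z z'). intros tau Htau.
    specialize (Hypos tau Htau). rewrite Hsplit. split; [|split].
    + destruct (sep_continuity z z' tau) as [Hcx Hcy]; try (apply (proj1 Hmot); exact Htau).
      apply continuity_pt_filterlim. apply continuity_pt_sep_angle; assumption.
    + apply angle_of_bounds.
    + apply is_arg_angle_of, Hypos.
  - intros theta Htheta tau1 tau2 Htau1 Htau2.
    assert (Heq : forall tau, a < tau < b -> theta tau = sep_angle z z' tau).
    { intros tau Htau. destruct (Htheta tau Htau) as (_ & Hrange & Harg).
      apply angle_of_unique; [apply Hypos, Htau | exact Hrange|].
      rewrite <- Hsplit. exact Harg. }
    assert (E1 : theta tau1 = sep_angle z z' 0).
    { rewrite Heq by lra. unfold sep_angle.
      destruct (Hsep1 tau1 Htau1) as [-> ->]. reflexivity. }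
    assert (E2 : theta tau2 = sep_angle z z' t).
    { rewrite Heq by lra. unfold sep_angle.
      destruct (Hsep2 tau2 Htau2) as [-> ->]. reflexivity. }
    cbv zeta. rewrite E1, E2.
    assert (Hlaw : sin (sep_angle z z' 0) * exp (- (Re mu / Im mu) * sep_angle z z' 0)
       = sin (sep_angle z z' t) * exp (- (Re mu / Im mu) * sep_angle z z' t)).
    { unfold sep_angle.
      rewrite !reflection_invariant by (apply Hy; lra).
      assert (HF := upper_phase_spiral mu s1 s2 0 t z z' Hmu Hph Ht Hy).
      cbv zeta in HF. unfold sep_angle in HF. rewrite HF, Hyeq. reflexivity. }
    split; [exact Hlaw|]. intros Hre.
    apply sin_eq_supplement.
    + split; [apply angle_of_bounds|].
      assert (Hratio := upper_phase_ratio_decreases mu s1 s2 0 t z z' ltac:(lra) Hmu Hph Ht Hy).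
      unfold sep_angle, angle_of. apply atan_increasing in Hratio. lra.
    + apply angle_of_bounds.
    + rewrite Hre in Hlaw.
      replace (- (0 / Im mu)) with 0 in Hlaw by (field; lra).
      rewrite !Rmult_0_l, exp_0, !Rmult_1_r in Hlaw. exact Hlaw.
Qed.
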